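(* Let $c>0$ and let $a,b,d,f>0$ be real numbers. Let $\tilde{x}_1=(0,0,0)$, $\tilde{x}_2=(a,0,0)$, $\tilde{x}_3=(-b,0,0)$, $\tilde{x}_4=(0,d,0)$, $\tilde{x}_5=(0,0,f)$ in $\mathbb{R}^3$. Then the position of a point source $s$ is uniquely determined by the time differences of arrival at these five observation points, and its emission moment is then also uniquely determined from the arrival times. That is: if $s,s'\in\mathbb{R}^3\setminus\{\tilde{x}_1,\dots,\tilde{x}_5\}$ are point sources with emission moments $t,t'\in\mathbb{R}$ and arrival times $T_i=t+c^{-1}|\tilde{x}_i-s|$, $T_i'=t'+c^{-1}|\tilde{x}_i-s'|$ $(i=1,\dots,5)$, and if $T_i-T_j=T_i'-T_j'$ for all $i,j\in\{1,\dots,5\}$, then $s=s'$. Moreover the emission moment is given by $t=T_1-c^{-1}|s-\tilde{x}_1|$, so that if in addition $T_1=T_1'$, then $t=t'$.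
   Context: $|\cdot|$ is the Euclidean norm on $\mathbb{R}^3$ and $c$ is the constant wave speed. A point source at position $s$ emitting a pulse at time $t$ is recorded at the observation point $\tilde{x}_i$ at the arrival time $T_i=t+c^{-1}|\tilde{x}_i-s|$. The time differences of arrival are $\Delta t_{ij}=T_i-T_j$. Source positions never coincide with observation points. *)

(* Defs.v *)
From mathcomp Require Import all_boot all_order all_algebra.
From mathcomp Require Import reals.

Set Implicit Arguments.
Unset Strict Implicit.
Unset Printing Implicit Defensive.

Import Order.TTheory GRing.Theory Num.Theory.
Local Open Scope ring_scope.

(* The norm [`|v|] of MathComp-Analysis on row vectors is the sup norm, hence
   a separate Euclidean norm. *)
Definition euclidean_norm (R : realType) (n : nat) (v : 'rV[R]_n) : R :=
  Num.sqrt (\sum_(k < n) v 0 k ^+ 2).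

Definition vec3 (R : realType) (x y z : R) : 'rV[R]_3 :=
  \row_(k < 3) tnth [tuple x; y; z] k.

(* Index [i : 'I_5] stands for the observation point numbered i + 1 in the
   1-based numbering, so that [ord0] is the one at the origin. *)
Definition observation_points (R : realType) (a b d f : R) (i : 'I_5) :
    'rV[R]_3 :=
  tnth [tuple vec3 0 0 0; vec3 a 0 0; vec3 (- b) 0 0; vec3 0 d 0; vec3 0 0 f] i.

Definition arrival_time (R : realType) (c : R) (x s : 'rV[R]_3) (t : R) : R :=
  t + c^-1 * euclidean_norm (x - s).

(* Main.v *)
Require Import Defs.
From mathcomp Require Import all_boot all_order all_algebra.
From mathcomp Require Import reals.
From mathcomp Require Import ring lra.

Set Implicit Arguments.
Unset Strict Implicit.
Unset Printing Implicit Defensive.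

Import Order.TTheory GRing.Theory Num.Theory.
Local Open Scope ring_scope.

(** Write [r_i] and [r'_i] for the distances from [s] and [s'] to the [i]-th
    observation point. Equal time differences of arrival mean that
    [r'_i = r_i + k] with the same [k] for every [i]. Once [k = 0] is known, the
    squared distances to the origin and to one point on each coordinate axis
    give back the coordinates, so that [s = s'].

    To see that [k = 0], apply Stewart's theorem to the three points on the
    first axis: [b r_2^2 + a r_3^2 - (a + b) r_1^2] is a constant, the same for
    [s] and [s']. Adding [k] to the three distances changes this quantity by
    [2 k (b r_2 + a r_3 - (a + b) r_1)], because the weights [b], [a] and
    [- (a + b)] sum to zero. Hence [k = 0] or [b r_2 + a r_3 = (a + b) r_1].
    The second case is equality in the triangle inequality, since the origin is
    the barycentre of the two other points with weights [b] and [a]; it forces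
    [s] onto the first axis ([tight_convexity_on_axis]). The relation is
    unchanged by the shift, so [s'] is on that axis too. For points of this
    axis, Pythagoras gives [(r_4 - r_1) (r_4 + r_1) = d^2]; as [r_4 - r_1] is
    common to both sources, so is [r_4 + r_1], and the shift vanishes
    ([shift_eq0_on_axis]). *)

(** The tight relation, once squared, says that [r2 * r3] is the inner product
    of the vectors from the source to the two end points, which is the equality
    case of Cauchy-Schwarz. Here [p] is the abscissa of the source and [w] the
    square of its distance to the axis. *)
Lemma tight_convexity_on_axis (F : realFieldType) (a b p w r1 r2 r3 : F) :
    0 < a -> 0 < b ->
    r1 ^+ 2 = p ^+ 2 + w -> r2 ^+ 2 = (a - p) ^+ 2 + w ->
    r3 ^+ 2 = (- b - p) ^+ 2 + w ->
  b * r2 + a * r3 = (a + b) * r1 -> w = 0.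
Proof.
move=> a_gt0 b_gt0 E1 E2 E3 tight.
have ab_neq0 : 2 * a * b != 0 by rewrite !mulf_neq0 ?gt_eqF.
have inner : r2 * r3 = (a - p) * (- b - p) + w.
  apply: (mulfI ab_neq0).
  have -> : 2 * a * b * (r2 * r3) =
      (b * r2 + a * r3) ^+ 2 - b ^+ 2 * r2 ^+ 2 - a ^+ 2 * r3 ^+ 2 by ring.
  by rewrite tight exprMn E1 E2 E3; ring.
have abD_neq0 : (a + b) ^+ 2 != 0 by rewrite expf_neq0 // gt_eqF ?addr_gt0.
apply: (mulfI abD_neq0); rewrite mulr0.
(* Lagrange's identity: the defect in Cauchy-Schwarz is [(a + b)^2 * w]. *)
have -> : (a + b) ^+ 2 * w = ((a - p) ^+ 2 + w) * ((- b - p) ^+ 2 + w) -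
    ((a - p) * (- b - p) + w) ^+ 2 by ring.
by rewrite -inner -E2 -E3; ring.
Qed.

Lemma shift_eq0_on_axis (F : realFieldType) (d k r1 r4 : F) :
    0 < d -> r4 ^+ 2 = r1 ^+ 2 + d ^+ 2 ->
  (r4 + k) ^+ 2 = (r1 + k) ^+ 2 + d ^+ 2 -> k = 0.
Proof.
move=> d_gt0 E E'.
have prod0 : (r4 - r1) * k = 0 by lra.
move/eqP: prod0; rewrite mulf_eq0 subr_eq0 => /orP[/eqP r41|/eqP //].
have : d ^+ 2 != 0 by rewrite expf_neq0 // gt_eqF.
by case/eqP; move: E; rewrite r41; lra.
Qed.

(** The [r]'s and the numbers [r + k] are the distances from the sources
    [(p, q, u)] and [(p', q', u')] to the origin, to the two other points of the
    first axis, and to the point of the second axis. *)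
Lemma distance_shift_eq0 (F : realFieldType)
    (a b d p q u p' q' u' k r1 r2 r3 r4 : F) :
    0 < a -> 0 < b -> 0 < d ->
    r1 ^+ 2 = p ^+ 2 + (q ^+ 2 + u ^+ 2) ->
    r2 ^+ 2 = (a - p) ^+ 2 + (q ^+ 2 + u ^+ 2) ->
    r3 ^+ 2 = (- b - p) ^+ 2 + (q ^+ 2 + u ^+ 2) ->
    r4 ^+ 2 = p ^+ 2 + ((d - q) ^+ 2 + u ^+ 2) ->
    (r1 + k) ^+ 2 = p' ^+ 2 + (q' ^+ 2 + u' ^+ 2) ->
    (r2 + k) ^+ 2 = (a - p') ^+ 2 + (q' ^+ 2 + u' ^+ 2) ->
    (r3 + k) ^+ 2 = (- b - p') ^+ 2 + (q' ^+ 2 + u' ^+ 2) ->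
    (r4 + k) ^+ 2 = p' ^+ 2 + ((d - q') ^+ 2 + u' ^+ 2) ->
  k = 0.
Proof.
move=> a_gt0 b_gt0 d_gt0 E1 E2 E3 E4 E1' E2' E3' E4'.
have stewart : b * r2 ^+ 2 + a * r3 ^+ 2 - (a + b) * r1 ^+ 2 =
    b * (r2 + k) ^+ 2 + a * (r3 + k) ^+ 2 - (a + b) * (r1 + k) ^+ 2.
  by rewrite E1 E2 E3 E1' E2' E3'; ring.
have : k * (b * r2 + a * r3 - (a + b) * r1) = 0 by lra.
move/eqP; rewrite mulf_eq0 subr_eq0 => /orP[/eqP //|/eqP tight].
have tight' : b * (r2 + k) + a * (r3 + k) = (a + b) * (r1 + k) by lra.
have ordinate0 (v w : F) : v ^+ 2 + w ^+ 2 = 0 -> v = 0.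
  by move/eqP; rewrite paddr_eq0 ?sqr_ge0 // !sqrf_eq0 => /andP[/eqP].
have q0 := ordinate0 _ _ (tight_convexity_on_axis a_gt0 b_gt0 E1 E2 E3 tight).
have q'0 :=
  ordinate0 _ _ (tight_convexity_on_axis a_gt0 b_gt0 E1' E2' E3' tight').
apply: (shift_eq0_on_axis d_gt0 (r1 := r1) (r4 := r4)).
  by rewrite E4 E1 q0; ring.
by rewrite E4' E1' q'0; ring.
Qed.

(** Multilateration from the origin and one point on an axis. The remaining
    coordinates enter only through [w], the sum of their squares. *)
Lemma coord_of_distances (F : realFieldType) (e p w p' w' : F) :
    e != 0 -> p ^+ 2 + w = p' ^+ 2 + w' ->
  (e - p) ^+ 2 + w = (e - p') ^+ 2 + w' -> p = p'.
Proof.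
move=> e_neq0 E0 Ee.
have e2_neq0 : 2 * e != 0 by rewrite mulf_neq0 ?pnatr_eq0.
by apply: (mulfI e2_neq0); lra.
Qed.

Lemma sqr_euclidean_norm_vec3B (R : realType) (x y z : R) (s : 'rV[R]_3) :
  euclidean_norm (vec3 x y z - s) ^+ 2 =
  (x - s 0 0) ^+ 2 + ((y - s 0 1) ^+ 2 + (z - s 0 2) ^+ 2).
Proof.
rewrite sqr_sqrtr; last by apply: sumr_ge0 => k _; exact: sqr_ge0.
rewrite !big_ord_recl big_ord0 addr0 !mxE.
by do !congr (_ + _); congr ((_ - s _ _) ^+ 2); apply/val_inj.
Qed.

Lemma euclidean_normB_sym (R : realType) n (v w : 'rV[R]_n) :
  euclidean_norm (v - w) = euclidean_norm (w - v).
Proof.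
by congr Num.sqrt; apply: eq_bigr => k _; rewrite -opprB mxE sqrrN.
Qed.

Theorem theorem2p4 (R : realType) (c a b d f : R)
    (c_gt0 : 0 < c) (a_gt0 : 0 < a) (b_gt0 : 0 < b) (d_gt0 : 0 < d)
    (f_gt0 : 0 < f)
    (x : 'I_5 -> 'rV[R]_3) (x_def : x = observation_points a b d f)
    (s s' : 'rV[R]_3) (s_off : forall i, s <> x i) (s'_off : forall i, s' <> x i)
    (t t' : R) (T T' : 'I_5 -> R)
    (T_def : forall i, T i = arrival_time c (x i) s t)
    (T'_def : forall i, T' i = arrival_time c (x i) s' t')
    (same_tdoa : forall i j, T i - T j = T' i - T' j) :
  [/\ s = s',
      t = T ord0 - c^-1 * euclidean_norm (s - x ord0)
    & T ord0 = T' ord0 -> t = t'].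
Proof.
have s_eq : s = s'.
  pose r i := euclidean_norm (x i - s).
  pose r' i := euclidean_norm (x i - s').
  have shift i : r' i = r i + (r' 0 - r 0).
    have cV_neq0 : c^-1 != 0 by rewrite invr_eq0 gt_eqF.
    apply: (mulfI cV_neq0).
    by have := same_tdoa i 0; rewrite !T_def !T'_def /arrival_time /r /r'; lra.
  have [x0 x1 x2 x3 x4] : [/\ x 0 = vec3 0 0 0, x 1 = vec3 a 0 0,
      x 2 = vec3 (- b) 0 0, x 3 = vec3 0 d 0 & x 4 = vec3 0 0 f] by rewrite x_def.
  have sqr_dist s0 : let r0 i := euclidean_norm (x i - s0) in
      let p := s0 0 0 in let q := s0 0 1 in let u := s0 0 2 in
      [/\ r0 0 ^+ 2 = p ^+ 2 + (q ^+ 2 + u ^+ 2),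
          r0 1 ^+ 2 = (a - p) ^+ 2 + (q ^+ 2 + u ^+ 2),
          r0 2 ^+ 2 = (- b - p) ^+ 2 + (q ^+ 2 + u ^+ 2),
          r0 3 ^+ 2 = p ^+ 2 + ((d - q) ^+ 2 + u ^+ 2)
        & r0 4 ^+ 2 = p ^+ 2 + (q ^+ 2 + (f - u) ^+ 2)].
    rewrite /= x0 x1 x2 x3 x4 !sqr_euclidean_norm_vec3B.
    by split; rewrite !sub0r !sqrrN.
  have [E0 E1 E2 E3 E4] := sqr_dist s.
  have [E0' E1' E2' E3' E4'] := sqr_dist s'.
  rewrite -!/(r _) in E0 E1 E2 E3 E4; rewrite -!/(r' _) in E0' E1' E2' E3' E4'.
  have k0 : r' 0 - r 0 = 0.
    by apply: (distance_shift_eq0 a_gt0 b_gt0 d_gt0 E0 E1 E2 E3);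
      rewrite -shift; eassumption.
  have rE i : r' i = r i by rewrite shift k0 addr0.
  rewrite !rE in E0' E1' E2' E3' E4'.
  have p_eq : s 0 0 = s' 0 0.
    apply: (@coord_of_distances _ a _ (s 0 1 ^+ 2 + s 0 2 ^+ 2) _
      (s' 0 1 ^+ 2 + s' 0 2 ^+ 2)); [exact: lt0r_neq0|lra|lra].
  have q_eq : s 0 1 = s' 0 1.
    apply: (@coord_of_distances _ d _ (s 0 0 ^+ 2 + s 0 2 ^+ 2) _
      (s' 0 0 ^+ 2 + s' 0 2 ^+ 2)); [exact: lt0r_neq0|lra|lra].
  have u_eq : s 0 2 = s' 0 2.
    apply: (@coord_of_distances _ f _ (s 0 0 ^+ 2 + s 0 1 ^+ 2) _
      (s' 0 0 ^+ 2 + s' 0 1 ^+ 2)); [exact: lt0r_neq0|lra|lra].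
  apply/rowP => -[[|[|[|//]]] lt_k3].
  - by have -> : Ordinal lt_k3 = 0 by exact/val_inj.
  - by have -> : Ordinal lt_k3 = 1 by exact/val_inj.
  - by have -> : Ordinal lt_k3 = 2 by exact/val_inj.
split=> //.
- by rewrite T_def /arrival_time euclidean_normB_sym addrK.
- by rewrite T_def T'_def /arrival_time s_eq => /addIr.
Qed.
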